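(* Let $n=k+l$ with $0\le l\le n/2$. Every finite-dimensional irreducible representation $V$ of the reflection algebra $\mathcal B(n,l)$ is a highest weight representation. Moreover, $V$ contains a unique (up to a constant factor) highest vector.
   Context: Reflection algebra. Let $n=k+l$ with $k,l\ge 0$ integers, $\varepsilon_i=1$ for $1\le i\le k$ and $\varepsilon_i=-1$ for $k+1\le i\le n$. The reflection algebra $\mathcal B(n,l)$ is the unital associative algebra over $\mathbb C$ with generators $b_{ij}^{(r)}$, $r\ge 1$, $1\le i,j\le n$. Put $b_{ij}(u)=\sum_{r\ge 0} b_{ij}^{(r)}u^{-r}$ with $b_{ij}^{(0)}=\delta_{ij}\varepsilon_i$, and $B(u)=\sum_{i,j} b_{ij}(u)\otimes E_{ij}\in\mathcal B(n,l)[[u^{-1}]]\otimes \mathrm{End}\,\mathbb C^n$ ($E_{ij}$ the matrix units). The defining relations are the reflection equation $$R(u-v)B_1(u)R(u+v)B_2(v)=B_2(v)R(u+v)B_1(u)R(u-v)$$ and the unitary condition $B(u)B(-u)=1$. Here $R(u)=1-Pu^{-1}$, $P=\sum_{i,j}E_{ij}\otimes E_{ji}$, the subscripts $1,2$ show in which copy of $\mathrm{End}\,\mathbb C^n$ in $\mathcal B(n,l)[[u^{-1},v^{-1}]]\otimes\mathrm{End}\,\mathbb C^n\otimes\mathrm{End}\,\mathbb C^n$ the matrix lies, and the relation is understood coefficientwise after multiplying by $u^2-v^2$. A representation $V$ of $\mathcal B(n,l)$ is called highest weight if there is a nonzero vector $\xi\in V$ such that $V$ is generated by $\xi$, $b_{ij}(u)\xi=0$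 for $1\le i<j\le n$, and $b_{ii}(u)\xi=\mu_i(u)\xi$ for $1\le i\le n$, for some formal series $\mu_i(u)\in\varepsilon_i+u^{-1}\mathbb C[[u^{-1}]]$. Such a vector $\xi$ is called a highest vector of $V$. *)

(* Defs.v *)
From HB Require Import structures.
From mathcomp Require Import all_boot all_algebra.
From mathcomp Require Import finmap boolp reals complex mxtens.
From mathcomp.multinomials Require Import monalg.

Set Implicit Arguments.
Unset Strict Implicit.
Unset Printing Implicit Defensive.

Import GRing.Theory.

Local Open Scope ring_scope.
Local Open Scope complex_scope.
Local Open Scope quotient_scope.

Section FreeAlgebra.
Context (K : comNzRingType) (I : choiceType).

(* monalg declares an algType structure only for commutative monomials; it is
   therefore attached here to an alias. *)
Definition free_alg := {malg K[{fmonom I}]}.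

HB.instance Definition _ := GRing.Lalgebra.on free_alg.

Lemma free_alg_scaleAr (c : K) (x y : free_alg) : c *: (x * y) = x * (c *: y).
Proof.
rewrite [x * y]malgME [RHS](malgMEw (fsubset_refl _) (msuppZ_le c y)).
rewrite scaler_sumr; apply: eq_bigr => k _.
rewrite scaler_sumr; apply: eq_bigr => k' _.
rewrite (mcoeffZ c y k'); apply/malgP=> m; apply: (etrans (mcoeffZ c _ m)).
rewrite [RHS]mcoeffU; apply: (etrans (congr1 ( *%R c) (mcoeffU _ _ _))).
by rewrite mulrnAr mulrCA.
Qed.

HB.instance Definition _ :=
  GRing.Lalgebra_isAlgebra.Build K free_alg free_alg_scaleAr.

Definition free_alg_gen (i : I) : free_alg := << fmu i >>.

(* The algebra morphism sending every generator to 0. *)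
Definition augmentation (x : free_alg) : K :=
  mcoeff (mone : {fmonom I}) (x : {malg K[{fmonom I}]}).

HB.instance Definition _ := GRing.RMorphism.copy augmentation
  (mcoeff (mone : {fmonom I}) : {malg K[{fmonom I}]} -> K).

Lemma augmentation_gen i : augmentation (free_alg_gen i) = 0.
Proof. by rewrite /augmentation mcoeffU1 fmP fm1 fmuE. Qed.

End FreeAlgebra.

Section PresentedAlgebra.
Context (K : comNzRingType) (A : algType K) (S : A -> Prop).

Inductive two_sided_ideal : A -> Prop :=
| ideal_gen x : S x -> two_sided_ideal x
| ideal0 : two_sided_ideal 0
| idealD x y : two_sided_ideal x -> two_sided_ideal y -> two_sided_ideal (x + y)
| idealM a x b : two_sided_ideal x -> two_sided_ideal (a * x * b).

Lemma idealN x : two_sided_ideal x -> two_sided_ideal (- x).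
Proof. by move=> /(idealM (-1) 1); rewrite mulr1 mulN1r. Qed.

Lemma idealZ c x : two_sided_ideal x -> two_sided_ideal (c *: x).
Proof. by move=> /(idealM (c *: 1) 1); rewrite mulr1 -scalerAl mul1r. Qed.

Definition ideal_equiv (x y : A) : bool := `[< two_sided_ideal (x - y) >].

Lemma ideal_equiv_is_equiv : equiv_class_of ideal_equiv.
Proof.
split=> [x | x y | y x z].
- by apply/asboolP; rewrite subrr; exact: ideal0.
- by apply: asbool_equiv_eq; split=> /idealN; rewrite opprB.
- move=> /asboolP hxy /asboolP hyz; apply/asboolP.
  by rewrite -(subrKA y); exact: idealD.
Qed.

Canonical ideal_equiv_equiv := EquivRelPack ideal_equiv_is_equiv.
Canonical ideal_equiv_encModRel := defaultEncModRel ideal_equiv.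

Definition quot_alg := {eq_quot ideal_equiv}.

HB.instance Definition _ : EqQuotient A ideal_equiv quot_alg :=
  EqQuotient.on quot_alg.
HB.instance Definition _ := Choice.on quot_alg.

Lemma quot_algP (x y : A) :
  reflect (two_sided_ideal (x - y)) (x == y %[mod quot_alg]).
Proof. by rewrite piE; exact: asboolP. Qed.

Definition quot_add := lift_op2 quot_alg +%R.
Definition quot_opp := lift_op1 quot_alg -%R.
Definition quot_mul := lift_op2 quot_alg *%R.
Definition quot_scale c := lift_op1 quot_alg ( *:%R c).
Definition quot_zero := lift_cst quot_alg 0.
Definition quot_one := lift_cst quot_alg 1.

Lemma pi_quot_add : {morph \pi : x y / x + y >-> quot_add x y}.
Proof.
move=> x y; unlock quot_add; apply/eqP/quot_algP.
rewrite opprD addrACA; apply: idealD; apply/quot_algP.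
  by rewrite reprK.
by rewrite reprK.
Qed.
Canonical pi_quot_add_morph := PiMorph2 pi_quot_add.

Lemma pi_quot_opp : {morph \pi : x / - x >-> quot_opp x}.
Proof.
move=> x; unlock quot_opp; apply/eqP/quot_algP.
by rewrite -opprD; apply/idealN/quot_algP; rewrite reprK.
Qed.
Canonical pi_quot_opp_morph := PiMorph1 pi_quot_opp.

Lemma pi_quot_scale c : {morph \pi : x / c *: x >-> quot_scale c x}.
Proof.
move=> x; unlock quot_scale; apply/eqP/quot_algP.
by rewrite -scalerBr; apply/idealZ/quot_algP; rewrite reprK.
Qed.
Canonical pi_quot_scale_morph c := PiMorph1 (pi_quot_scale c).

Lemma pi_quot_mul : {morph \pi : x y / x * y >-> quot_mul x y}.
Proof.
move=> x y; unlock quot_mul; apply/eqP/quot_algP.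
set x' := repr _; set y' := repr _.
have -> : x * y - x' * y' = 1 * (x - x') * y + x' * (y - y') * 1.
  by rewrite mul1r mulr1 mulrBl mulrBr addrA subrK.
by apply: idealD; apply/idealM/quot_algP; rewrite reprK.
Qed.
Canonical pi_quot_mul_morph := PiMorph2 pi_quot_mul.

Canonical pi_quot_zero_morph := PiConst quot_zero.
Canonical pi_quot_one_morph := PiConst quot_one.

Lemma quot_addA : associative quot_add.
Proof. by elim/quotW=> x; elim/quotW=> y; elim/quotW=> z; rewrite !piE addrA. Qed.

Lemma quot_addC : commutative quot_add.
Proof. by elim/quotW=> x; elim/quotW=> y; rewrite !piE addrC. Qed.

Lemma quot_add0 : left_id quot_zero quot_add.
Proof. by elim/quotW=> x; rewrite !piE add0r. Qed.

Lemma quot_addN : left_inverse quot_zero quot_opp quot_add.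
Proof. by elim/quotW=> x; rewrite !piE addNr. Qed.

HB.instance Definition _ :=
  GRing.isZmodule.Build quot_alg quot_addA quot_addC quot_add0 quot_addN.

Lemma quot_mulA : associative quot_mul.
Proof. by elim/quotW=> x; elim/quotW=> y; elim/quotW=> z; rewrite !piE mulrA. Qed.

Lemma quot_mul1l : left_id quot_one quot_mul.
Proof. by elim/quotW=> x; rewrite !piE mul1r. Qed.

Lemma quot_mul1r : right_id quot_one quot_mul.
Proof. by elim/quotW=> x; rewrite !piE mulr1. Qed.

Lemma quot_mulDl : left_distributive quot_mul +%R.
Proof.
elim/quotW=> x; elim/quotW=> y; elim/quotW=> z.
by rewrite -[_ + _]/(quot_add _ _) -[in RHS]/(quot_add _ _) !piE mulrDl.
Qed.

Lemma quot_mulDr : right_distributive quot_mul +%R.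
Proof.
elim/quotW=> x; elim/quotW=> y; elim/quotW=> z.
by rewrite -[_ + _]/(quot_add _ _) -[in RHS]/(quot_add _ _) !piE mulrDr.
Qed.

HB.instance Definition _ := GRing.Zmodule_isPzRing.Build quot_alg
  quot_mulA quot_mul1l quot_mul1r quot_mulDl quot_mulDr.

Lemma quot_scaleA c d x : quot_scale c (quot_scale d x) = quot_scale (c * d) x.
Proof. by elim/quotW: x => x; rewrite !piE scalerA. Qed.

Lemma quot_scale1 : left_id 1 quot_scale.
Proof. by elim/quotW=> x; rewrite !piE scale1r. Qed.

Lemma quot_scaleDr : right_distributive quot_scale +%R.
Proof.
move=> c; elim/quotW=> x; elim/quotW=> y.
by rewrite -[_ + _]/(quot_add _ _) -[in RHS]/(quot_add _ _) !piE scalerDr.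
Qed.

Lemma quot_scaleDl x : {morph quot_scale^~ x : c d / c + d}.
Proof.
elim/quotW: x => x c d.
by rewrite -[in RHS]/(quot_add _ _) !piE scalerDl.
Qed.

HB.instance Definition _ := GRing.Zmodule_isLmodule.Build K quot_alg
  quot_scaleA quot_scale1 quot_scaleDr quot_scaleDl.

Lemma quot_scaleAl c (x y : quot_alg) : c *: (x * y) = (c *: x) * y.
Proof.
elim/quotW: x => x; elim/quotW: y => y.
rewrite -[x in c *: x]/(quot_mul _ _) -[RHS]/(quot_mul (quot_scale _ _) _).
by rewrite -[LHS]/(quot_scale _ _) !piE scalerAl.
Qed.

Lemma quot_scaleAr c (x y : quot_alg) : c *: (x * y) = x * (c *: y).
Proof.
elim/quotW: x => x; elim/quotW: y => y.
rewrite -[x in c *: x]/(quot_mul _ _) -[RHS]/(quot_mul _ (quot_scale _ _)).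
by rewrite -[LHS]/(quot_scale _ _) !piE scalerAr.
Qed.

Definition quot_proj (x : A) : quot_alg := \pi x.

Lemma quot_proj_additive : additive quot_proj.
Proof.
move=> x y; rewrite /quot_proj.
by rewrite -[RHS]/(quot_add _ (quot_opp _)) !piE.
Qed.

Lemma quot_proj_multiplicative : multiplicative quot_proj.
Proof.
split=> [x y|]; rewrite /quot_proj.
  by rewrite -[RHS]/(quot_mul _ _) !piE.
by rewrite -[RHS]/quot_one !piE.
Qed.

Lemma quot_proj_scalable : scalable quot_proj.
Proof.
by move=> c x; rewrite /quot_proj -[RHS]/(quot_scale _ _) !piE.
Qed.

HB.instance Definition _ :=
  GRing.isAdditive.Build A quot_alg quot_proj quot_proj_additive.
HB.instance Definition _ :=
  GRing.isMultiplicative.Build A quot_alg quot_proj quot_proj_multiplicative.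
HB.instance Definition _ :=
  GRing.isScalable.Build K A quot_alg *:%R quot_proj quot_proj_scalable.

Lemma quot_proj_surj (y : quot_alg) : exists x, quot_proj x = y.
Proof. by exists (repr y); rewrite /quot_proj reprK. Qed.

Lemma quot_proj_eq0 (x : A) : quot_proj x = 0 <-> two_sided_ideal x.
Proof.
rewrite -(raddf0 quot_proj) -{2}[x]subr0 /quot_proj.
by split=> [/eqP/quot_algP | h]; last apply/eqP/quot_algP.
Qed.

End PresentedAlgebra.

Section ReflectionRelations.
Context (A : pzRingType) (n l : nat).

(* Indices start at 0 and k = n - l. *)
Definition eps (i : 'I_n) : A := if (i < n - l)%N then 1 else -1.

(* A series sum_(r, s) (f r s) u^-r v^-s with matrix coefficients. *)
Definition series2 N := nat -> nat -> 'M[A]_N.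

Definition mul_series2 N (f g : series2 N) : series2 N := fun r s =>
  \sum_(i < r.+1) \sum_(j < s.+1) f i j *m g (r - i)%N (s - j)%N.

(* 'M_(n * n) is End C^n (x) End C^n, through the Kronecker product *t. *)
Definition flip : 'M[A]_(n * n) :=
  \sum_(i < n) \sum_(j < n) tensmx (delta_mx i j) (delta_mx j i).

(* (u - v) u^-1 v^-1 R(u - v) = v^-1 - u^-1 - P u^-1 v^-1 *)
Definition R_sub : series2 (n * n) := fun r s =>
  match r, s with
  | 0, 1 => 1%:M
  | 1, 0 => - 1%:M
  | 1, 1 => - flip
  | _, _ => 0
  end.

(* (u + v) u^-1 v^-1 R(u + v) = v^-1 + u^-1 - P u^-1 v^-1 *)
Definition R_add : series2 (n * n) := fun r s =>
  match r, s with
  | 0, 1 => 1%:M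
  | 1, 0 => 1%:M
  | 1, 1 => - flip
  | _, _ => 0
  end.

Section Sides.
(* The coefficients B r of a series B(u) = sum_r (B r) u^-r. *)
Variable B : nat -> 'M[A]_n.

Definition B_1 : series2 (n * n) := fun r s =>
  if s is 0 then tensmx (B r) 1%:M else 0.

Definition B_2 : series2 (n * n) := fun r s =>
  if r is 0 then tensmx 1%:M (B s) else 0.

(* The two sides of the reflection equation, multiplied by
   (u ^ 2 - v ^ 2) u^-2 v^-2 so that only nonnegative powers of u^-1 and v^-1
   occur. *)
Definition reflection_lhs : series2 (n * n) :=
  mul_series2 R_sub (mul_series2 B_1 (mul_series2 R_add B_2)).

Definition reflection_rhs : series2 (n * n) :=
  mul_series2 B_2 (mul_series2 R_add (mul_series2 B_1 R_sub)).

(* The coefficient of u^-r in B(u) B(- u). *)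
Definition unitary_lhs (r : nat) : 'M[A]_n :=
  \sum_(i < r.+1) (-1) ^+ (r - i) *: (B i *m B (r - i)%N).

Definition unitary_rhs (r : nat) : 'M[A]_n := if r is 0 then 1%:M else 0.

End Sides.

(* The series B(u) whose coefficient of u^-(r+1) has entries g r i j. *)
Definition Bseries (g : nat -> 'I_n -> 'I_n -> A) (r : nat) : 'M[A]_n :=
  \matrix_(i, j) if r is r'.+1 then g r' i j else (eps i) *+ (i == j).

End ReflectionRelations.

Section MapRelations.
Context (A A' : pzRingType) (f : {rmorphism A -> A'}) (n l : nat).

Lemma map_mul_series2 N (F G : series2 A N) (F' G' : series2 A' N) :
  (forall r s, map_mx f (F r s) = F' r s) ->
  (forall r s, map_mx f (G r s) = G' r s) ->
  forall r s, map_mx f (mul_series2 F G r s) = mul_series2 F' G' r s.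
Proof.
move=> hF hG r s; rewrite /mul_series2 raddf_sum; apply: eq_bigr => i _.
by rewrite raddf_sum; apply: eq_bigr => j _; rewrite /= map_mxM hF hG.
Qed.

Lemma map_flip : map_mx f (flip A n) = flip A' n.
Proof.
rewrite /flip raddf_sum; apply: eq_bigr => i _; rewrite raddf_sum.
by apply: eq_bigr => j _; rewrite /= map_mxT !map_delta_mx.
Qed.

Lemma map_R_sub r s : map_mx f (R_sub A n r s) = R_sub A' n r s.
Proof.
by case: r => [|[|r]]; case: s => [|[|s]] //=;
  rewrite ?raddf0 ?map_mx1 ?map_mxN ?map_mx1 ?map_flip.
Qed.

Lemma map_R_add r s : map_mx f (R_add A n r s) = R_add A' n r s.
Proof.
by case: r => [|[|r]]; case: s => [|[|s]] //=;
  rewrite ?raddf0 ?map_mx1 ?map_mxN ?map_flip.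
Qed.

Variables (B : nat -> 'M[A]_n) (B' : nat -> 'M[A']_n).
Hypothesis hB : forall r, map_mx f (B r) = B' r.

Lemma map_B_1 r s : map_mx f (B_1 B r s) = B_1 B' r s.
Proof. by case: s => [|s] /=; rewrite ?raddf0 ?map_mxT ?map_mx1 ?hB. Qed.

Lemma map_B_2 r s : map_mx f (B_2 B r s) = B_2 B' r s.
Proof. by case: r => [|r] /=; rewrite ?raddf0 ?map_mxT ?map_mx1 ?hB. Qed.

Lemma map_reflection_lhs r s :
  map_mx f (reflection_lhs B r s) = reflection_lhs B' r s.
Proof.
move: r s; apply: map_mul_series2; first exact: map_R_sub.
apply: map_mul_series2; first exact: map_B_1.
by apply: map_mul_series2; [exact: map_R_add | exact: map_B_2].
Qed.

Lemma map_reflection_rhs r s :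
  map_mx f (reflection_rhs B r s) = reflection_rhs B' r s.
Proof.
move: r s; apply: map_mul_series2; first exact: map_B_2.
apply: map_mul_series2; first exact: map_R_add.
by apply: map_mul_series2; [exact: map_B_1 | exact: map_R_sub].
Qed.

Lemma map_unitary_lhs r : map_mx f (unitary_lhs B r) = unitary_lhs B' r.
Proof.
rewrite /unitary_lhs raddf_sum; apply: eq_bigr => i _ /=.
by rewrite map_mxZ map_mxM !hB rmorphXn rmorphN1.
Qed.

Lemma map_unitary_rhs r : map_mx f (unitary_rhs A n r) = unitary_rhs A' n r.
Proof. by case: r => [|r] /=; rewrite ?raddf0 ?map_mx1. Qed.

Lemma map_reflection_lhsE r s a c :
  f (reflection_lhs B r s a c) = reflection_lhs B' r s a c.
Proof. by rewrite -map_reflection_lhs [RHS]mxE. Qed.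

Lemma map_reflection_rhsE r s a c :
  f (reflection_rhs B r s a c) = reflection_rhs B' r s a c.
Proof. by rewrite -map_reflection_rhs [RHS]mxE. Qed.

Lemma map_unitary_lhsE r i j : f (unitary_lhs B r i j) = unitary_lhs B' r i j.
Proof. by rewrite -map_unitary_lhs [RHS]mxE. Qed.

Lemma map_unitary_rhsE r i j :
  f (unitary_rhs A n r i j) = unitary_rhs A' n r i j.
Proof. by rewrite -map_unitary_rhs [RHS]mxE. Qed.

End MapRelations.

Section ConstantSolution.
(* B(u) = diag(eps) satisfies the relations; hence the algebra is nonzero. *)
Context (A : comPzRingType) (n l : nat).

Let G : 'M[A]_n := diag_mx (\row_i eps A l i).
Let B0 : nat -> 'M[A]_n := Bseries l (fun _ _ _ => 0).

Lemma Bseries0 r : B0 r = if r is 0 then G else 0.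
Proof. by apply/matrixP=> i j; case: r => [|r]; rewrite !mxE. Qed.

Lemma G_involutive : G *m G = 1%:M.
Proof.
apply/matrixP=> i j; rewrite mul_diag_mx !mxE /eps.
by case: eqP => [->|_]; rewrite ?mulr0n ?mulr0 // mulr1n;
  case: ifP; rewrite ?mulrNN mulr1.
Qed.

Lemma flipE i j k m : flip A n (mxtens_index (i, j)) (mxtens_index (k, m)) =
  ((i == m) && (j == k))%:R.
Proof.
rewrite /flip summxE (bigD1 i) //= summxE (bigD1 j) //= tensmxE !mxE !eqxx /=.
rewrite big1 ?addr0 => [|a ne]; last first.
  by rewrite tensmxE !mxE (eq_sym j a) (negPf ne) mulr0.
rewrite big1 ?addr0 => [|a ne]; last first.
  rewrite summxE big1 // => b _.
  by rewrite tensmxE !mxE eq_sym (negPf ne) mul0r.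
rewrite ?andbT ?andTb -natrM mulnb.
by rewrite andbC (eq_sym m) (eq_sym k).
Qed.

Lemma mul_flipl (X : 'M[A]_(n * n)) i j q :
  (flip A n *m X) (mxtens_index (i, j)) q = X (mxtens_index (j, i)) q.
Proof.
rewrite mxE (bigD1 (mxtens_index (j, i))) //= flipE !eqxx mul1r.
rewrite big1 ?addr0 // => p; case: p / (mxtens_indexP p) => a b.
rewrite (can_eq (@mxtens_indexK n n)) xpair_eqE flipE.
by rewrite (eq_sym a) (eq_sym b) andbC => /negPf->; rewrite mul0r.
Qed.

Lemma mul_flipr (X : 'M[A]_(n * n)) i j p :
  (X *m flip A n) p (mxtens_index (i, j)) = X p (mxtens_index (j, i)).
Proof.
rewrite mxE (bigD1 (mxtens_index (j, i))) //= flipE !eqxx mulr1.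
rewrite big1 ?addr0 // => q; case: q / (mxtens_indexP q) => a b.
rewrite (can_eq (@mxtens_indexK n n)) xpair_eqE flipE.
by move=> /negPf->; rewrite mulr0.
Qed.

Lemma mul_flip (X Y : 'M[A]_n) :
  flip A n *m tensmx X Y = tensmx Y X *m flip A n.
Proof.
apply/matrixP=> p q.
case: p / (mxtens_indexP p) => i j; case: q / (mxtens_indexP q) => k m.
by rewrite mul_flipl mul_flipr !tensmxE mulrC.
Qed.

Lemma mul_flip_flip : flip A n *m flip A n = 1%:M.
Proof.
apply/matrixP=> p q.
case: p / (mxtens_indexP p) => i j; case: q / (mxtens_indexP q) => k m.
rewrite mul_flipl flipE mxE (can_eq (@mxtens_indexK n n)) xpair_eqE.
by rewrite andbC.
Qed.

Lemma mul_series2_constl (C : series2 A (n * n)) (c : 'M_(n * n)) F r s :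
  (forall r s, C r s = if r is 0 then if s is 0 then c else 0 else 0) ->
  mul_series2 C F r s = c *m F r s.
Proof.
move=> hC; rewrite /mul_series2 big_ord_recl big_ord_recl /= hC !subn0.
rewrite !big1 ?addr0 // => [i _|i _]; last by rewrite hC mul0mx.
by rewrite big1 // => j _; rewrite hC mul0mx.
Qed.

Lemma mul_series2_constr (C : series2 A (n * n)) (c : 'M_(n * n)) F r s :
  (forall r s, C r s = if r is 0 then if s is 0 then c else 0 else 0) ->
  mul_series2 F C r s = F r s *m c.
Proof.
move=> hC; rewrite /mul_series2 big_ord_recr big_ord_recr /= hC !subnn.
rewrite !big1 ?add0r // => [i _|i _].
  rewrite hC; case E: (s - i)%N => [|//]; rewrite ?mulmx0 //.
  by move/eqP: E; rewrite subn_eq0 leqNgt ltn_ord.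
rewrite big1 // => j _; rewrite hC; case E: (r - i)%N => [|//];
  rewrite ?mulmx0 //.
by move/eqP: E; rewrite subn_eq0 leqNgt ltn_ord.
Qed.

Let G1 := tensmx G (1%:M : 'M_n).
Let G2 := tensmx (1%:M : 'M_n) G.

Lemma B_1_const r s :
  B_1 B0 r s = if r is 0 then if s is 0 then G1 else 0 else 0.
Proof. by case: s => [|s] /=; case: r => [|r] //; rewrite Bseries0 ?tens0mx. Qed.

Lemma B_2_const r s :
  B_2 B0 r s = if r is 0 then if s is 0 then G2 else 0 else 0.
Proof. by case: r => [|r] /=; case: s => [|s] //; rewrite Bseries0 ?tensmx0. Qed.

Lemma mul_series2_big (F H : series2 A (n * n)) r s :
  (forall r s, (1 < r)%N || (1 < s)%N -> F r s = 0) ->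
  (forall r s, (1 < r)%N || (1 < s)%N -> H r s = 0) ->
  (2 < r)%N || (2 < s)%N -> mul_series2 F H r s = 0.
Proof.
move=> hF hH rs; rewrite /mul_series2 big1 // => i _; rewrite big1 // => j _.
have [ij|/norP[]] := boolP ((1 < i)%N || (1 < j)%N).
  by rewrite hF ?mul0mx.
rewrite -!leqNgt => i1 j1; rewrite hH ?mulmx0 //.
case/orP: rs => h; apply/orP; [left | right]; rewrite ltn_subRL.
  exact: leq_ltn_trans (leq_add i1 (leqnn 1)) h.
exact: leq_ltn_trans (leq_add j1 (leqnn 1)) h.
Qed.

Lemma tens11 : tensmx 1%:M 1%:M = 1%:M :> 'M[A]_(n * n).
Proof.
apply/matrixP=> p q.
case: p / (mxtens_indexP p) => i j; case: q / (mxtens_indexP q) => k m.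
rewrite tensmxE !mxE (can_eq (@mxtens_indexK n n)) xpair_eqE.
by rewrite -natrM mulnb.
Qed.

Lemma reflection_const r s : reflection_lhs B0 r s = reflection_rhs B0 r s.
Proof.
pose L : series2 A (n * n) := fun r s => R_sub A n r s *m G1.
pose M : series2 A (n * n) := fun r s => R_add A n r s *m G2.
pose L' : series2 A (n * n) := fun r s => G1 *m R_sub A n r s.
pose M' : series2 A (n * n) := fun r s => G2 *m R_add A n r s.
have -> : reflection_lhs B0 r s = mul_series2 L M r s.
  apply: eq_bigr => i _; apply: eq_bigr => j _.
  rewrite (mul_series2_constl _ _ _ B_1_const) /L /M -!mulmxA.
  by rewrite (mul_series2_constr _ _ _ B_2_const).
have -> : reflection_rhs B0 r s = mul_series2 M' L' r s.
  rewrite /reflection_rhs (mul_series2_constl _ _ _ B_2_const).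
  rewrite [mul_series2 (R_add _ _) _ _ _]/mul_series2 mulmx_sumr.
  apply: eq_bigr => i _; rewrite mulmx_sumr; apply: eq_bigr => j _.
  by rewrite (mul_series2_constl _ _ _ B_1_const) /L' /M' -!mulmxA.
have big (X : series2 A (n * n)) : (X = R_sub A n \/ X = R_add A n) ->
    forall r s, (1 < r)%N || (1 < s)%N -> X r s = 0.
  by case=> ->; case=> [|[|?]] [|[|?]].
have hS := big _ (or_introl erefl); have hA := big _ (or_intror erefl).
have [rs|/norP[]] := boolP ((2 < r)%N || (2 < s)%N).
  rewrite !mul_series2_big //.
  - by move=> a b ab; rewrite /M' hA ?mulmx0.
  - by move=> a b ab; rewrite /L' hS ?mulmx0.
  - by move=> a b ab; rewrite /L hS ?mul0mx.
  - by move=> a b ab; rewrite /M hA ?mul0mx.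
rewrite -!leqNgt.
pose P := flip A n.
have PG1 : P *m G1 = G2 *m P by exact: mul_flip.
have PG2 : P *m G2 = G1 *m P by exact: mul_flip.
have G11 : G1 *m G1 = 1%:M by rewrite tensmx_mul G_involutive mulmx1 tens11.
have G22 : G2 *m G2 = 1%:M by rewrite tensmx_mul G_involutive mulmx1 tens11.
have G12 : G1 *m G2 = G2 *m G1 by rewrite !tensmx_mul !mulmx1 !mul1mx.
have PP : P *m P = 1%:M by exact: mul_flip_flip.
have PG1a X : P *m (G1 *m X : 'M_(n * n)) = G2 *m (P *m X).
  by rewrite mulmxA PG1 -mulmxA.
have G11a X : G1 *m (G1 *m X : 'M_(n * n)) = X by rewrite mulmxA G11 mul1mx.
have G22a X : G2 *m (G2 *m X : 'M_(n * n)) = X by rewrite mulmxA G22 mul1mx.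
have PG2a X : P *m (G2 *m X : 'M_(n * n)) = G1 *m (P *m X).
  by rewrite mulmxA PG2 -mulmxA.
case: r => [|[|[|//]]] _; case: s => [|[|[|//]]] _;
  rewrite /mul_series2 !big_ord_recl !big_ord0 /L /M /L' /M' /=.
all: rewrite !(mul0mx, mulmx0, mul1mx, mulmx1, mulNmx, mulmxN, opprK).
all: rewrite ?oppr0 ?add0r ?addr0 -?mulmxA //.
all: rewrite -?/P.
- by rewrite subrr addNr.
- by rewrite PG2 PG1a PG1 PG2 G11a G22a addrC.
- by rewrite G12.
- by rewrite PG2 PG1a PG1 PG2 G11a G22a addrC.
- by rewrite PG2 G11a PP PG1a PP mulmx1 G22.
Qed.

Lemma unitary_const r : unitary_lhs B0 r = unitary_rhs A n r.
Proof.
rewrite /unitary_lhs big_ord_recl big1 => [|i _]; last first.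
  by rewrite Bseries0 mul0mx scaler0.
by rewrite addr0 subn0 !Bseries0; case: r => [|r]; rewrite ?mulmx0 ?scaler0 //
  expr0 scale1r G_involutive.
Qed.

End ConstantSolution.

Section ReflectionAlgebra.
Context (R : realType) (n l : nat).

(* (r, i, j) indexes b_ij^(r+1). *)
Definition free_refl := free_alg R[i] (nat * 'I_n * 'I_n)%type.

Definition free_gen (r : nat) (i j : 'I_n) : free_refl :=
  free_alg_gen _ (r, i, j).

Definition free_B : nat -> 'M[free_refl]_n := Bseries l free_gen.

Variant reflection_relation : free_refl -> Prop :=
| reflection_equation r s a c : reflection_relation
    (reflection_lhs free_B r s a c - reflection_rhs free_B r s a c)
| unitary_condition r i j : reflection_relation
    (unitary_lhs free_B r i j - unitary_rhs free_refl n r i j).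

Definition refl_alg := quot_alg reflection_relation.

HB.instance Definition _ := GRing.PzRing.on refl_alg.
HB.instance Definition _ := GRing.Lmodule.on refl_alg.

Lemma augmentation_B r :
  map_mx (@augmentation R[i] _) (free_B r) =
  Bseries l (fun _ _ _ => 0) r :> 'M[R[i]]_n.
Proof.
apply/matrixP=> i j; rewrite !mxE; case: r => [|r].
  by rewrite rmorphMn /eps; case: ifP; rewrite ?rmorphN1 ?rmorph1.
exact: (augmentation_gen R[i] (r, i, j)).
Qed.

Lemma augmentation_ideal (x : free_refl) :
  two_sided_ideal reflection_relation x -> augmentation x = 0.
Proof.
elim=> {x} [x | | x y _ hx _ hy | a x c _ hx].
- case=> [r s a c | r i j]; rewrite rmorphB; apply/eqP; rewrite subr_eq0;
    apply/eqP.
    apply: (etrans (map_reflection_lhsE augmentation_B r s a c)).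
    apply: (etrans _ (esym (map_reflection_rhsE augmentation_B r s a c))).
    by rewrite reflection_const.
  apply: (etrans (map_unitary_lhsE augmentation_B r i j)).
  apply: (etrans _ (esym (map_unitary_rhsE (@augmentation R[i] _) r i j))).
  by rewrite unitary_const.
- exact: rmorph0.
- by rewrite rmorphD /= hx hy addr0.
- by rewrite !rmorphM /= hx mulr0 mul0r.
Qed.

Lemma refl_alg_oner_neq0 : 1 != 0 :> refl_alg.
Proof.
apply/eqP; rewrite -(rmorph1 (quot_proj reflection_relation)).
move=> /quot_proj_eq0/augmentation_ideal/eqP.
by rewrite rmorph1 oner_eq0.
Qed.

HB.instance Definition _ :=
  GRing.PzSemiRing_isNonZero.Build refl_alg refl_alg_oner_neq0.
HB.instance Definition _ := GRing.Lmodule_isLalgebra.Build R[i] refl_alg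
  (@quot_scaleAl _ _ reflection_relation).
HB.instance Definition _ := GRing.Lalgebra_isAlgebra.Build R[i] refl_alg
  (@quot_scaleAr _ _ reflection_relation).

(* refl_B r i j is b_ij^(r), including b_ij^(0) = delta_ij eps_i. *)
Definition refl_B (r : nat) : 'M[refl_alg]_n :=
  map_mx (quot_proj reflection_relation) (free_B r).

Lemma refl_B0 i j : refl_B 0 i j = eps refl_alg l i *+ (i == j).
Proof.
rewrite [LHS]mxE [free_B _ _ _]mxE rmorphMn /eps.
by case: ifP; rewrite ?rmorphN1 ?rmorph1.
Qed.

Lemma refl_B_reflection r s :
  reflection_lhs refl_B r s = reflection_rhs refl_B r s.
Proof.
have hB p : map_mx (quot_proj reflection_relation) (free_B p) = refl_B p by [].
apply/matrixP=> a c.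
rewrite -(map_reflection_lhsE hB) -(map_reflection_rhsE hB); apply/eqP.
rewrite -subr_eq0 -rmorphB.
by apply/eqP/quot_proj_eq0/ideal_gen; exact: reflection_equation.
Qed.

Lemma refl_B_unitary r : unitary_lhs refl_B r = unitary_rhs refl_alg n r.
Proof.
have hB p : map_mx (quot_proj reflection_relation) (free_B p) = refl_B p by [].
apply/matrixP=> i j.
rewrite -(map_unitary_lhsE hB) -(map_unitary_rhsE (quot_proj _)); apply/eqP.
rewrite -subr_eq0 -rmorphB.
by apply/eqP/quot_proj_eq0/ideal_gen; exact: unitary_condition.
Qed.

Section Representations.
Variable V : vectType R[i].

Record representation := Representation {
  rep_act :> {linear refl_alg -> 'End(V)};
  rep_act1 : rep_act 1 = \1%VF;
  rep_actM : forall x y, rep_act (x * y) = (rep_act x \o rep_act y)%VF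
}.

Definition irreducible (rho : representation) : Prop :=
  fullv != 0%VS :> {vspace V} /\
  forall W : {vspace V},
    (forall x : refl_alg, (rho x @: W <= W)%VS) -> W = 0%VS \/ W = fullv.

Definition highest_vector (rho : representation) (xi : V) : Prop :=
  [/\ xi != 0,
      forall v : V, exists x : refl_alg, rho x xi = v,
      forall i j : 'I_n, (i < j)%N -> forall r, rho (refl_B r i j) xi = 0
    & exists mu : 'I_n -> nat -> R[i], forall i : 'I_n,
        mu i 0%N = eps R[i] l i /\
        forall r, rho (refl_B r i i) xi = mu i r *: xi].

Definition highest_weight (rho : representation) : Prop :=
  exists xi, highest_vector rho xi.

End Representations.

End ReflectionAlgebra.

(* Main.v *)
Require Import Defs.
From HB Require Import structures.
From mathcomp Require Import all_boot all_algebra.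
From mathcomp Require Import boolp reals complex mxtens zify ring.
From mathcomp.multinomials Require Import monalg.

(* Entrywise, the reflection equation shows that a commutator of two generators is
   a combination of quadratic monomials of lower total index, and that a suitable
   combination H of the b_ii^(1) satisfies [H, b_ij(u)] = (j - i) b_ij(u).
   Existence: let E be an eigenspace of H in V whose eigenvalue a is such that no
   a + p, p > 0, is an eigenvalue. Then b_ij(u) kills E for i < j, and the b_ii(u)
   preserve E. They also commute there: with S_j(u, v) = sum_a b_ja(u) b_aj(v) and
   T_j(u, v) = S_j(u, v) - S_j(v, u), all commutators [b_ii(u), b_jj(v)] on E are
   controlled by the T_j, and the reflection equation gives
   (u + v) T_j = (1 + #{a > j}) T_j once T_a = 0 for all a > j. A common
   eigenvector of the b_ii(u) in E is a highest vector.
   Uniqueness: since commutators have lower total index, any word in the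
   generators applied to a highest vector xi of H-eigenvalue a is a combination of
   words in the b_ij with i >= j applied to xi, so V is C xi plus eigenspaces of H
   for a - p, p > 0. Hence another highest vector of eigenvalue a' is in C xi or
   a' < a; by symmetry it is in C xi. *)

Set Implicit Arguments.
Unset Strict Implicit.
Unset Printing Implicit Defensive.

Import GRing.Theory Num.Theory VectorInternalTheory.

Local Open Scope ring_scope.
Local Open Scope complex_scope.

(** * The reflection equation entrywise *)

Section TensorEntries.
Context (A : pzRingType) (n : nat).
Implicit Types (X : 'M[A]_n) (M : 'M[A]_(n * n)).

Lemma sum_mxtens_index (V : nmodType) (F : 'I_(n * n) -> V) :
  \sum_p F p = \sum_i \sum_j F (mxtens_index (i, j)).
Proof.
rewrite pair_bigA /= (reindex (@mxtens_index n n)) /=.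
  by apply: eq_bigr => -[i j].
by exists (@mxtens_unindex n n) => p _; rewrite ?mxtens_indexK ?mxtens_unindexK.
Qed.

Lemma tens_mul1l X M i k q :
  (tensmx X 1%:M *m M) (mxtens_index (i, k)) q =
  \sum_a X i a * M (mxtens_index (a, k)) q.
Proof.
rewrite mxE sum_mxtens_index; apply: eq_bigr => a _.
rewrite (bigD1 k) //= tensmxE mxE eqxx mulr1 big1 ?addr0 // => b ne.
by rewrite tensmxE mxE eq_sym (negPf ne) mulr0 mul0r.
Qed.

Lemma tens_mul1r X M i k q :
  (tensmx 1%:M X *m M) (mxtens_index (i, k)) q =
  \sum_a X k a * M (mxtens_index (i, a)) q.
Proof.
rewrite mxE sum_mxtens_index exchange_big; apply: eq_bigr => a _.
rewrite (bigD1 i) //= tensmxE mxE eqxx mul1r big1 ?addr0 // => b ne.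
by rewrite tensmxE mxE eq_sym (negPf ne) mul0r mul0r.
Qed.

Lemma flip_entry i j k m : flip A n (mxtens_index (i, j)) (mxtens_index (k, m)) =
  ((i == m) && (j == k))%:R.
Proof.
rewrite /flip summxE (bigD1 i) //= summxE (bigD1 j) //= tensmxE !mxE !eqxx /=.
rewrite !big1 ?addr0 => [|a ne|a ne].
- by rewrite -natrM mulnb andbC (eq_sym m) (eq_sym k).
- rewrite summxE big1 // => b _.
  by rewrite tensmxE !mxE eq_sym (negPf ne) mul0r.
- by rewrite tensmxE !mxE (eq_sym j a) (negPf ne) mulr0.
Qed.

Lemma flip_mull M i j q :
  (flip A n *m M) (mxtens_index (i, j)) q = M (mxtens_index (j, i)) q.
Proof.
rewrite mxE sum_mxtens_index (bigD1 j) //= (bigD1 i) //= flip_entry !eqxx mul1r.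
rewrite !big1 ?addr0 // => [a ne|a ne].
- rewrite big1 // => b _.
  by rewrite flip_entry (eq_sym j) (negPf ne) andbF mul0r.
- by rewrite flip_entry (eq_sym i) (negPf ne) mul0r.
Qed.

Lemma flip_mulr M i j p :
  (M *m flip A n) p (mxtens_index (i, j)) = M p (mxtens_index (j, i)).
Proof.
rewrite mxE sum_mxtens_index (bigD1 j) //= (bigD1 i) //= flip_entry !eqxx mulr1.
rewrite !big1 ?addr0 // => [a ne|a ne].
- by rewrite big1 // => b _; rewrite flip_entry (negPf ne) mulr0.
- by rewrite flip_entry (negPf ne) andbF mulr0.
Qed.

Let T1 X : 'M_(n * n) := tensmx X 1%:M.
Let T2 X : 'M_(n * n) := tensmx 1%:M X.
Let P := flip A n.

Lemma tens12E X Y i j k m :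
  (T1 X *m T2 Y) (mxtens_index (i, k)) (mxtens_index (j, m)) = X i j * Y k m.
Proof.
rewrite tens_mul1l (bigD1 j) //= tensmxE mxE eqxx mul1r big1 ?addr0 // => a ne.
by rewrite tensmxE mxE (negPf ne) mul0r mulr0.
Qed.

Lemma tens21E X Y i j k m :
  (T2 Y *m T1 X) (mxtens_index (i, k)) (mxtens_index (j, m)) = Y k m * X i j.
Proof.
rewrite tens_mul1r (bigD1 m) //= tensmxE mxE eqxx mulr1 big1 ?addr0 // => a ne.
by rewrite tensmxE mxE (negPf ne) mulr0 mulr0.
Qed.

Lemma tens1P2E X Y i j k m :
  (T1 X *m (P *m T2 Y)) (mxtens_index (i, k)) (mxtens_index (j, m)) =
  (\sum_a X i a * Y a m) *+ (k == j).
Proof.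
rewrite tens_mul1l -sumrMnl; apply: eq_bigr => a _.
by rewrite flip_mull tensmxE mxE mulr_natl mulrnAr.
Qed.

Lemma tens2P1E X Y i j k m :
  (T2 Y *m (P *m T1 X)) (mxtens_index (i, k)) (mxtens_index (j, m)) =
  (\sum_a Y k a * X a j) *+ (i == m).
Proof.
rewrite tens_mul1r -sumrMnl; apply: eq_bigr => a _.
by rewrite flip_mull tensmxE mxE mulr_natr mulrnAr.
Qed.

End TensorEntries.

Section EntryRelation.
Context (A : pzRingType) (n : nat) (B : nat -> 'M[A]_n).

(* The coefficient of u^-r in u^-2 B(u): with the two leading zeros the entries of
   the reflection equation have the same form in all bidegrees. *)
Definition pad2 (r : nat) : 'M[A]_n := if r is r'.+2 then B r' else 0.

Let a r : 'M_(n * n) := tensmx (pad2 r) 1%:M.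
Let b r : 'M_(n * n) := tensmx 1%:M (pad2 r).
Let P := flip A n.

(** The coefficients of u^-1 v^-1 F(u, v). The scaled R factors live in bidegrees (0, 1), (1, 0),
    (1, 1), so a product with one is three shifts of [F] without truncated subtraction. *)
Definition pad1 (F : series2 A (n * n)) : series2 A (n * n) := fun r s =>
  if r is r'.+1 then if s is s'.+1 then F r' s' else 0 else 0.

Lemma mul_series2_supp2 (R F : series2 A (n * n)) r s :
  (forall r s, (1 < r)%N || (1 < s)%N -> R r s = 0) ->
  R 0%N 0%N = 0 ->
  mul_series2 R F r s =
  R 0%N 1%N *m pad1 F r.+1 s + R 1%N 0%N *m pad1 F r s.+1
   + R 1%N 1%N *m pad1 F r s.
Proof.
move=> hR R0; rewrite /mul_series2.
have inner i : \sum_(j < s.+1) R i j *m F (r - i)%N (s - j)%N =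
    R i 0%N *m F (r - i)%N s +
    (if s is s'.+1 then R i 1%N *m F (r - i)%N s' else 0).
  rewrite big_ord_recl subn0; congr (_ + _).
  case: s => [|s]; first by rewrite big_ord0.
  rewrite big_ord_recl /= subSS subn0 big1 ?addr0 // => j _.
  by rewrite hR ?mul0mx ?orbT.
rewrite big_ord_recl inner subn0 R0 mul0mx add0r.
case: r inner => [|r] inner.
  rewrite big_ord0 addr0 !mulmx0 !addr0.
  by case: s {inner} => [|s] /=; rewrite ?mulmx0.
rewrite big_ord_recl inner /= subSS subn0 big1 => [|i _]; last first.
  by rewrite inner hR // mul0mx add0r; case: s {inner} => // s; rewrite hR ?mul0mx.
by rewrite addr0 addrA; case: s {inner} => [|s] /=; rewrite ?mulmx0 ?add0r ?addr0.
Qed.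

Lemma mul_R_sub F r s : mul_series2 (R_sub A n) F r s =
  pad1 F r.+1 s - pad1 F r s.+1 - P *m pad1 F r s.
Proof.
rewrite mul_series2_supp2 //; first by rewrite /= mul1mx !mulNmx mul1mx.
by case=> [|[|?]] [|[|?]].
Qed.

Lemma mul_R_add F r s : mul_series2 (R_add A n) F r s =
  pad1 F r.+1 s + pad1 F r s.+1 - P *m pad1 F r s.
Proof.
rewrite mul_series2_supp2 //; first by rewrite /= !mul1mx mulNmx.
by case=> [|[|?]] [|[|?]].
Qed.

Let a0 : a 0%N = 0. Proof. exact: tens0mx. Qed.
Let a1 : a 1%N = 0. Proof. exact: tens0mx. Qed.
Let b0 : b 0%N = 0. Proof. exact: tensmx0. Qed.
Let b1 : b 1%N = 0. Proof. exact: tensmx0. Qed.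

Lemma mul_B_1 F r s :
  mul_series2 (B_1 B) F r s = \sum_(i < r.+1) a i.+2 *m F (r - i)%N s.
Proof.
apply: eq_bigr => i _; rewrite big_ord_recl subn0 big1 ?addr0 // => j _.
by rewrite mul0mx.
Qed.

Lemma mul_B_2 F r s :
  mul_series2 (B_2 B) F r s = \sum_(j < s.+1) b j.+2 *m F r (s - j)%N.
Proof.
rewrite /mul_series2 big_ord_recl [X in _ + X]big1 ?addr0 => [|i _].
  by apply: eq_bigr => j _; rewrite subn0.
by rewrite big1 // => j _; rewrite mul0mx.
Qed.

Let R_add_B2 := mul_series2 (R_add A n) (B_2 B).

Let R_add_B2_0 s : R_add_B2 0%N s = b s.+1.
Proof.
rewrite /R_add_B2 mul_R_add /= mulmx0 subr0 addr0.
by case: s => [|s] //=; rewrite b1.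
Qed.

Let R_add_B2_1 s : R_add_B2 1%N s = b s.+2 - P *m b s.+1.
Proof.
by rewrite /R_add_B2 mul_R_add /=; case: s => [|s]//=; rewrite ?b1 ?add0r ?mulmx0.
Qed.

Let R_add_B2_2 r s : R_add_B2 r.+2 s = 0.
Proof.
by rewrite /R_add_B2 mul_R_add /=; case: s => [|s] /=; rewrite mulmx0 oppr0 !addr0.
Qed.

(** The scaled R(u + v) B_2(v) has degree at most 1 in u^-1, so only the last two terms of the
    convolution with B_1(u) survive. *)
Lemma lhs_inner r s : pad1 (mul_series2 (B_1 B) R_add_B2) r s =
  a r.+1 *m b s + a r *m (b s.+1 - P *m b s).
Proof.
case: r => [|r]; first by rewrite a0 a1 !mul0mx addr0.
case: s => [|s]; first by rewrite b0 b1 !mulmx0 subr0 mulmx0 addr0.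
rewrite /= mul_B_1 big_ord_recr /= subnn R_add_B2_0 addrC; congr (_ + _).
case: r => [|r]; first by rewrite big_ord0 a1 mul0mx.
rewrite big_ord_recr /= subSnn R_add_B2_1 big1 ?add0r // => i _.
suff [k ->] : exists k, (r.+1 - i)%N = k.+2 by rewrite R_add_B2_2 mulmx0.
by exists (r - i).-1; rewrite subSn ?prednK ?subn_gt0 // ltnW.
Qed.

Lemma reflection_lhsE r s : reflection_lhs B r s =
  (a r.+2 *m b s - a r *m b s.+2)
  - a r.+1 *m (P *m b s) + a r *m (P *m b s.+1)
  - P *m (a r.+1 *m b s) - P *m (a r *m b s.+1)
  + P *m (a r *m (P *m b s)).
Proof.
rewrite /reflection_lhs mul_R_sub !lhs_inner.
rewrite !mulmxDr !mulmxN !(opprD, opprB, opprK) !addrA.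
(* Terms 2 and 4 are the two copies of [a r.+1 *m b s.+1], with opposite signs. *)
by rewrite [LHS](ACl (1*5*3*6*7*8*9*(2*4))) /= subrr addr0.
Qed.

Let B1_R_sub := mul_series2 (B_1 B) (R_sub A n).

Let B1_R_sub_0 r : B1_R_sub r 0%N = - a r.+1.
Proof.
rewrite /B1_R_sub mul_B_1; case: r => [|r].
  by rewrite big_ord_recl big_ord0 addr0 a1 oppr0 mulmx0.
rewrite !big_ord_recr /= subnn subSnn /= mulmx0 addr0 mulmxN mulmx1.
rewrite big1 ?add0r // => i _; rewrite subSn ?(ltnW (ltn_ord i)) //.
by case: (r - i)%N (subn_gt0 i r) => [|k] /=; rewrite ?ltn_ord ?mulmx0.
Qed.

Let B1_R_sub_1 r : B1_R_sub r 1%N = a r.+2 - a r.+1 *m P.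
Proof.
rewrite /B1_R_sub mul_B_1; case: r => [|r].
  by rewrite big_ord_recl big_ord0 addr0 a1 mul0mx subr0 mulmx1.
rewrite !big_ord_recr /= subnn subSnn /= mulmx1 mulmxN addrC.
rewrite big1 ?add0r // => i _; rewrite subSn ?(ltnW (ltn_ord i)) //.
by case: (r - i)%N (subn_gt0 i r) => [|k] /=; rewrite ?ltn_ord ?mulmx0.
Qed.

Let B1_R_sub_2 r s : B1_R_sub r s.+2 = 0.
Proof.
rewrite /B1_R_sub mul_B_1 big1 // => i _.
by case: (r - i)%N => [|[|k]]; rewrite mulmx0.
Qed.

Let R_add_B1_R_sub := mul_series2 (R_add A n) B1_R_sub.

Let R_add_B1_R_sub_0 r : R_add_B1_R_sub r 0%N = - a r.
Proof.
rewrite /R_add_B1_R_sub mul_R_add; case: r => [|r] /=.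
  by rewrite a0 mulmx0 oppr0 !addr0.
by rewrite B1_R_sub_0 mulmx0 subr0 add0r.
Qed.

Let R_add_B1_R_sub_1 r : R_add_B1_R_sub r 1%N = P *m a r - a r *m P.
Proof.
rewrite /R_add_B1_R_sub mul_R_add; case: r => [|r] /=.
  by rewrite B1_R_sub_0 a0 a1 !mulmx0 mul0mx oppr0 !addr0.
by rewrite !B1_R_sub_0 B1_R_sub_1 mulmxN opprK addKr addrC.
Qed.

Let R_add_B1_R_sub_2 r : R_add_B1_R_sub r 2%N =
  a r.+2 - a r.+1 *m P - P *m a r.+1 + P *m (a r *m P).
Proof.
rewrite /R_add_B1_R_sub mul_R_add; case: r => [|r] /=.
  by rewrite B1_R_sub_1 a0 a1 !mulmx0 !mul0mx !mulmx0 oppr0 !addr0.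
by rewrite !B1_R_sub_1 B1_R_sub_2 addr0 mulmxBr opprB addrA addrAC.
Qed.

Let R_add_B1_R_sub_3 r s : R_add_B1_R_sub r s.+3 = 0.
Proof.
rewrite /R_add_B1_R_sub mul_R_add.
by case: r => [|r] /=; rewrite !B1_R_sub_2 mulmx0 oppr0 !addr0.
Qed.

(** Symmetrically, the scaled R(u + v) B_1(u) R(u - v) has degree at most 2 in v^-1, so three terms
    of the convolution with B_2(v) survive. *)
Lemma reflection_rhsE r s : reflection_rhs B r s =
  b s *m (a r.+2 - a r.+1 *m P - P *m a r.+1 + P *m (a r *m P))
   + b s.+1 *m (P *m a r - a r *m P) - b s.+2 *m a r.
Proof.
rewrite /reflection_rhs mul_B_2 -/B1_R_sub -/R_add_B1_R_sub.
case: s => [|[|s]].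
- rewrite big_ord_recl big_ord0 R_add_B1_R_sub_0 b0 b1.
  by rewrite !mul0mx !add0r addr0 mulmxN.
- rewrite !big_ord_recl big_ord0 R_add_B1_R_sub_0 R_add_B1_R_sub_1 b1.
  by rewrite !mul0mx !add0r addr0 mulmxN.
- rewrite !big_ord_recr /= subnn subSnn R_add_B1_R_sub_0 R_add_B1_R_sub_1.
  rewrite [(s.+2 - s)%N]subSn ?leqnSn // subSnn R_add_B1_R_sub_2 mulmxN.
  rewrite big1 ?add0r // => i _.
  rewrite !subSn ?(ltnW (ltn_ord i)) ?leqW // ?(ltnW (ltn_ord i)) //.
  by rewrite -(subnSK (ltn_ord i)) R_add_B1_R_sub_3 mulmx0.
Qed.

End EntryRelation.

Lemma mx_entryD (A : nmodType) m p (M N : 'M[A]_(m, p)) i j :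
  (M + N) i j = M i j + N i j.
Proof. exact: mxE. Qed.

Lemma mx_entryN (A : zmodType) m p (M : 'M[A]_(m, p)) i j :
  (- M) i j = - M i j.
Proof. exact: mxE. Qed.

(** An outer P exchanges the two row or the two column indices; a P between B_1 and B_2 contracts an
    index, which gives a sum times a Kronecker delta. *)
Lemma reflection_entries (A : pzRingType) (n : nat) (B : nat -> 'M[A]_n)
    (c := pad2 B) r s i j k m :
  reflection_lhs B r s = reflection_rhs B r s ->
  c r.+2 i j * c s k m - c r i j * c s.+2 k m
   - (\sum_a c r.+1 i a * c s a m) *+ (k == j)
   + (\sum_a c r i a * c s.+1 a m) *+ (k == j)
   - c r.+1 k j * c s i m - c r k j * c s.+1 i m
   + (\sum_a c r k a * c s a m) *+ (i == j) =
  c s k m * c r.+2 i j - c s k j * c r.+1 i m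
   - (\sum_a c s k a * c r.+1 a j) *+ (i == m)
   + (\sum_a c s k a * c r a m) *+ (i == j)
   + ((\sum_a c s.+1 k a * c r a j) *+ (i == m) - c s.+1 k j * c r i m)
   - c s.+2 k m * c r i j.
Proof.
move=> /matrixP/(_ (mxtens_index (i, k)) (mxtens_index (j, m))).
rewrite reflection_lhsE reflection_rhsE !(mulmxDr, mulmxN).
rewrite ![in X in X -> _](mx_entryD, mx_entryN).
rewrite !flip_mull !mulmxA !flip_mulr -!mulmxA.
by rewrite !tens12E !tens21E !tens1P2E !tens2P1E.
Qed.

Arguments pad2 : simpl never.

(** Collects the commutators on the left. The delta multiples become atoms, and [ring] is applied to
    each coordinate. *)
Lemma reflection_rearrange (F : fieldType) (V : vectType F) (a b c : bool)
    (x1 x2 x3 x4 x5 x6 x7 y1 y2 y3 y4 y5 y6 y7 : V) :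
  x1 - x2 - x3 *+ a + x4 *+ a - x5 - x6 + x7 *+ c =
    y1 - y2 - y3 *+ b + y4 *+ c + (y5 *+ b - y6) - y7 ->
  (x1 - y1) - (x2 - y7) =
  x5 + x6 - y2 - y6 + (x3 - x4) *+ a - (y3 - y5) *+ b - (x7 - y4) *+ c.
Proof.
rewrite !mulrnBl.
move: (x3 *+ a) (x4 *+ a) (y3 *+ b) (y5 *+ b) (x7 *+ c) (y4 *+ c).
move=> {}x3 {}x4 {}y3 {}y5 {}x7 {}y4 E; apply: v2r_inj; apply/rowP=> k.
move: E => /(congr1 (fun w => v2r w 0 k)).
rewrite !(linearB, linearD) /= !mxE => /eqP; rewrite -subr_eq0 => /eqP E.
by apply/eqP; rewrite -subr_eq0; apply/eqP; rewrite -[RHS]E; ring.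
Qed.

(** * The generators as operators on V *)

Section Action.
Context (R : realType) (n l : nat) (V : vectType R[i]) (rho : representation n l V).
Local Notation C := R[i].

(** With the padding, [op r.+2 i j] is the action of b_ij^(r): [op 0] and [op 1] vanish, [op 2] is
    the constant term. *)
Definition op r i j : 'End(V) := rho (pad2 (@refl_B R n l) r i j).

Definition op_sq r s i j (v : V) : V := \sum_a op r i a (op s a j v).

Lemma rep_act_mul x y v : rho (x * y) v = rho x (rho y v).
Proof. by rewrite rep_actM comp_lfunE. Qed.

Lemma op0 i j : op 0 i j = 0.
Proof. by rewrite /op mxE linear0. Qed.

Lemma op1 i j : op 1 i j = 0.
Proof. by rewrite /op mxE linear0. Qed.

Lemma op_eps i j v : op 2 i j v = (eps C l i *+ (i == j)) *: v.
Proof.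
rewrite /op refl_B0 linearMn /eps; case: eqP => _; last first.
  by rewrite !mulr0n zero_lfunE scale0r.
rewrite !mulr1n; case: ifP => _.
  by rewrite rep_act1 id_lfunE scale1r.
by rewrite linearN rep_act1 opp_lfunE id_lfunE scaleN1r.
Qed.

Definition act v (x : refl_alg R n l) : V := rho x v.

Lemma act_is_linear v : linear (act v).
Proof. by move=> c x y; rewrite /act linearP add_lfunE scale_lfunE. Qed.

HB.instance Definition _ v :=
  GRing.isLinear.Build C (refl_alg R n l) V *:%R (act v) (act_is_linear v).

(** A shift [r.+1] is multiplication by u, and [s.+1] by v. In series, the left side is (u^2 -
    v^2)[b_ij(u), b_km(v)], the first four terms on the right carry the factor u + v, and the next
    two differences of [op_sq] the factor u - v. *)
Lemma reflection_op r s i j k m v :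
  (op r.+2 i j (op s k m v) - op s k m (op r.+2 i j v))
   - (op r i j (op s.+2 k m v) - op s.+2 k m (op r i j v)) =
  op r.+1 k j (op s i m v) + op r k j (op s.+1 i m v)
   - op s k j (op r.+1 i m v) - op s.+1 k j (op r i m v)
   + (op_sq r.+1 s i m v - op_sq r s.+1 i m v) *+ (k == j)
   - (op_sq s r.+1 k j v - op_sq s.+1 r k j v) *+ (i == m)
   - (op_sq r s k m v - op_sq s r k m v) *+ (i == j).
Proof.
have actM r' s' i' j' k' m' : act v (pad2 (@refl_B R n l) r' i' j' *
    pad2 (@refl_B R n l) s' k' m') = op r' i' j' (op s' k' m' v).
  by rewrite /act rep_act_mul.
have sqE p q i' j' b : act v ((\sum_a pad2 (@refl_B R n l) p i' a *
    pad2 (@refl_B R n l) q a j') *+ nat_of_bool b) = op_sq p q i' j' v *+ b.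
  by rewrite raddfMn raddf_sum; congr (_ *+ _); apply: eq_bigr => a _; exact: actM.
have E := congr1 (act v)
  (reflection_entries i j k m (refl_B_reflection R n l r s)).
rewrite !(raddfB, raddfD) /= !actM !sqE in E.
exact: (reflection_rearrange E).
Qed.
End Action.

(* Multiplication by u sends the coefficient array f r s of u^-r v^-s to f r.+1 s:
   the equation u f = (a v + b) f has no nonzero solution in u^-1 V[[u^-1, v^-1]]. *)
Lemma shift_eq0 (F : comPzRingType) (V : lmodType F) (a b : F)
    (f : nat -> nat -> V) :
  (forall s, f 0%N s = 0) ->
  (forall r s, f r.+1 s = a *: f r s.+1 + b *: f r s) ->
  forall r s, f r s = 0.
Proof.
move=> f0 fS; elim=> [//|r IHr] s.
by rewrite fS !IHr !scaler0 addr0.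
Qed.

Section Coordinates.
Context (F : fieldType) (V : vectType F).

Definition vcoord (k : 'I_(dim V)) (v : V) : F := v2r v 0 k.

Lemma vcoordP u v : (forall k, vcoord k u = vcoord k v) -> u = v.
Proof. by move=> uv; apply: v2r_inj; apply/rowP. Qed.

Lemma vcoordD k u v : vcoord k (u + v) = vcoord k u + vcoord k v.
Proof. by rewrite /vcoord linearD mxE. Qed.

Lemma vcoordN k v : vcoord k (- v) = - vcoord k v.
Proof. by rewrite /vcoord linearN mxE. Qed.

End Coordinates.

(* Identities in the abelian group V, proved coordinatewise by ring. *)
Ltac coord_ring :=
  let k := fresh "k" in
  apply: vcoordP => k; rewrite !(vcoordD, vcoordN);
  repeat match goal with |- context [vcoord k ?v] => move: (vcoord k v) => ? end;
  ring.

(** * Commutation of the diagonal generators on singular vectors *)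

Section Commuting.
Context (R : realType) (n l : nat) (V : vectType R[i]) (rho : representation n l V).
Local Notation op := (op rho).
Local Notation op_sq := (op_sq rho).
Implicit Types (i j : 'I_n) (v : V).

Definition singular v := forall r i j, (i < j)%N -> op r i j v = 0.

Lemma op_sq0l s i j v : op_sq 0 s i j v = 0.
Proof. by rewrite /op_sq big1 // => a _; rewrite op0 zero_lfunE. Qed.

Lemma op_sq0r s i j v : op_sq s 0 i j v = 0.
Proof. by rewrite /op_sq big1 // => a _; rewrite op0 zero_lfunE linear0. Qed.

Definition diag_comm i j v r s := op r i i (op s j j v) - op s j j (op r i i v).

Definition sq_comm j v r s := op_sq r s j j v - op_sq s r j j v.

(** With all indices equal, the reflection equation says (u - v - 1) X = 0 for X = (u +
    v)[b_ii(u), b_ii(v)] - T_i(u, v), where [sq_comm] gives T_i; hence the constants 1 and 1 in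
    [shift_eq0]. *)
Lemma diag_comm_sq i v r s :
  diag_comm i i v r.+1 s + diag_comm i i v r s.+1 = sq_comm i v r s.
Proof.
apply/subr0_eq; move: r s; apply: (@shift_eq0 _ _ 1 1) => [s|r s].
  by rewrite /diag_comm /sq_comm op_sq0l op_sq0r !op0 !op1
    !(zero_lfunE, linear0, addr0, subrr).
have := reflection_op rho r s i i i i v.
rewrite !eqxx !mulr1n => /(canRL (subrK _)) E.
rewrite /diag_comm /sq_comm E !scale1r; coord_ring.
Qed.

(** Descending induction on j. [Y a] is the share of an index a > j in T_j; indices a < j contribute
    nothing, as b_aj(u) kills a singular vector. *)
Lemma singular_sq_comm v : singular v -> forall j r s, sq_comm j v r s = 0.
Proof.
move=> vsing j; have [d] := ubnP (n - j); elim: d j => // d IHd j djn.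
pose Y (a : 'I_n) r s := op r j a (op s a j v) - op s j a (op r a j v).
(* Adding the equation for b_ja(u), b_aj(v) to the one with u and v exchanged cancels the products
   of b_aa and b_jj, leaving (u - v)((u + v) Y_a - T_j - T_a) = 0, with T_a = 0 by induction. *)
have YE (a : 'I_n) r s : (j < a)%N -> Y a r.+1 s + Y a r s.+1 = sq_comm j v r s.
  move=> ja; apply/subr0_eq; move: r s; apply: (@shift_eq0 _ _ 1 0) => [s|r s].
    by rewrite /Y /sq_comm op_sq0l op_sq0r !op0 !op1
      !(zero_lfunE, linear0, addr0, subrr).
  have Ta p q : sq_comm a v p q = 0.
    by apply: IHd; rewrite ltnS in djn; apply: leq_trans djn; rewrite ltn_sub2l.
  have na : (j == a) = false by apply/negbTE; rewrite neq_ltn ja.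
  have := reflection_op rho r s j a a j v.
  have := reflection_op rho s r j a a j v.
  rewrite !eqxx na !mulr1n !mulr0n !(vsing _ _ _ ja) !(linear0, subr0, addr0).
  move=> /(canRL (subrK _)) E1 /(canRL (subrK _)) E2.
  have /subr0_eq T1 := Ta r.+1 s.
  have /subr0_eq T2 := Ta r s.+1.
  rewrite /Y /sq_comm E1 E2 T1 T2 scale1r scale0r addr0; coord_ring.
have TE r s : sq_comm j v r s =
    diag_comm j j v r s + \sum_(a < n | (j < a)%N) Y a r s.
  rewrite /sq_comm /op_sq -sumrB (bigD1 j) //=; congr (_ + _).
  rewrite [RHS]big_mkcond [LHS]big_mkcond; apply: eq_bigr => a _.
  case: (ltngtP j a) => [ja|ja|/val_inj ->]; last by rewrite eqxx.
    by rewrite neq_ltn ja orbT.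
  by rewrite !(vsing _ _ _ ja) !linear0 addr0 if_same.
move=> r s; move: r s.
(* After multiplication by u + v, the diagonal commutator and each [Y a] become T_j, so T_j is
   counted 1 + #{a > j} times. *)
apply: (@shift_eq0 _ _ (-1) (#|[pred a : 'I_n | (j < a)%N]|.+1)%:R) => [s|r s].
  by rewrite /sq_comm op_sq0l op_sq0r subr0.
rewrite scaleN1r addrC; apply: (canRL (addrK _)).
rewrite [X in X + _]TE [X in _ + X]TE addrACA diag_comm_sq -big_split /=.
rewrite (eq_bigr (fun=> sq_comm j v r s)) => [|a ja]; last exact: YE.
by rewrite sumr_const scaler_nat mulrS.
Qed.

Lemma singular_diag_comm v : singular v ->
  forall i j r s, op r i i (op s j j v) = op s j j (op r i i v).
Proof.
move=> vsing.
(* Here the equation reduces to (u^2 - v^2)[b_ii(u), b_jj(v)] = - T_j(u, v) = 0; the two uses of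
   [shift_eq0] cancel u + v and u - v. *)
have lt i j r s : (i < j)%N -> diag_comm i j v r s = 0.
  move=> ij; move: r s; apply: (@shift_eq0 _ _ (-1) 0) => [s|r s].
    by rewrite /diag_comm op0 zero_lfunE zero_lfunE !linear0 addr0.
  rewrite scaleN1r scale0r addr0; apply/eqP; rewrite -addr_eq0; apply/eqP.
  move: r s; apply: (@shift_eq0 _ _ 1 0) => [s|r s].
    by rewrite /diag_comm !op0 !op1 !(zero_lfunE, linear0, addr0, subrr).
  have nij : (i == j) = false by apply/negbTE; rewrite neq_ltn ij.
  have := reflection_op rho r s i i j j v.
  rewrite (eq_sym j) !eqxx nij !mulr1n !mulr0n !(vsing _ _ _ ij).
  rewrite !(linear0, subr0, addr0).
  have /subr0_eq T0 := singular_sq_comm vsing j r s.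
  rewrite T0 !subrr => /subr0_eq E.
  by rewrite scale1r scale0r addr0 [LHS]addrC /diag_comm E.
move=> i j r s; apply/subr0_eq; case: (ltngtP i j) => [ij|ji|/val_inj ->].
- exact: lt.
- by rewrite -opprB -/(diag_comm _ _ _ _ _) lt ?oppr0.
move: r s; apply: (@shift_eq0 _ _ (-1) 0) => [s|r s].
  by rewrite op0 zero_lfunE zero_lfunE !linear0 addr0.
rewrite scaleN1r scale0r addr0; apply/eqP; rewrite -addr_eq0; apply/eqP.
by rewrite (diag_comm_sq j v r s) singular_sq_comm.
Qed.

End Commuting.

(** * Eigenvectors of commuting operators *)

Section Eigenvectors.
Context (F : closedFieldType) (V : vectType F).
Implicit Types (f : 'End(V)) (W : {vspace V}).

Lemma invariant_eigenvector f W :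
  W != 0%VS -> {in W, forall v, f v \in W} ->
  exists a v, [/\ v \in W, v != 0 & f v = a *: v].
Proof.
move=> W0 fW.
pose A := lin1_mx
  (v2r \o vsproj W \o f \o vsval \o r2v : 'rV_(dim (subvs_of W)) -> _).
have [|a] := @closed_rootP _ (char_poly A) _.
  rewrite size_char_poly; have : (0 < \dim W)%N by rewrite lt0n dimv_eq0.
  by rewrite -[\dim W]/(dim (subvs_of W)); case: (dim _).
rewrite -eigenvalue_root_char => /eigenvalueP[u uA u0].
exists a, (vsval (r2v u)); split; first exact: subvsP.
  rewrite -(linear0 (@vsval _ _ W)) (inj_eq val_inj).
  by rewrite (can2_eq r2vK v2rK) linear0.
move: uA; rewrite mul_rV_lin1 /= => /(congr1 r2v); rewrite v2rK linearZ /=.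
move=> /(congr1 vsval); rewrite linearZ /= vsprojK //.
by apply: fW; exact: subvsP.
Qed.

(** Induction on the dimension of [W]: if some [f i] is not scalar on [W], one of its eigenspaces in
    [W] is proper and, by commutation, stable under the whole family, which may be infinite. *)
Lemma common_eigenvector_in (I : Type) (f : I -> 'End(V)) W :
  W != 0%VS -> (forall i, {in W, forall v, f i v \in W}) ->
  (forall i j, {in W, forall v, f i (f j v) = f j (f i v)}) ->
  exists v, [/\ v \in W, v != 0 & forall i, exists a, f i v = a *: v].
Proof.
have [d] := ubnP (\dim W); elim: d W => // d IHd W dW W0 fW fC.
have [scal|/existsNP[i /forallNP nscal]] :=
  pselect (forall i, exists a, {in W, forall v, f i v = a *: v}).
  exists (vpick W); split; rewrite ?vpick0 ?memv_pick // => i.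
  by have [a fa] := scal i; exists a; apply: fa; exact: memv_pick.
have [a [v [vW v0 fv]]] := invariant_eigenvector W0 (fW i).
pose U := (W :&: lker (f i - a *: \1%VF))%VS.
have UP u : (u \in U) = (u \in W) && (f i u == a *: u).
  by rewrite memv_cap memv_ker add_lfunE opp_lfunE scale_lfunE id_lfunE subr_eq0.
have [| |||w [wU w0 wE]] := IHd U.
- rewrite -ltnS; apply: leq_trans dW; rewrite ltnS.
  have := dimvS (capvSl W (lker (f i - a *: \1%VF))); rewrite -/U leq_eqVlt.
  case/orP=> // /eqP dUW; case: (nscal a) => u uW; apply/eqP.
  have /eqP UW : (U == W) by rewrite eqEdim capvSl dUW leqnn.
  by move: uW; rewrite -UW UP => /andP[].
- by apply/eqP => /vspaceP/(_ v); rewrite UP vW fv eqxx memv0 (negPf v0).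
- move=> j u; rewrite !UP => /andP[uW /eqP fu].
  by rewrite fW //= fC // fu linearZ.
- by move=> j k u; rewrite UP => /andP[uW _]; exact: fC.
by exists w; split=> //; move: wU; rewrite UP => /andP[].
Qed.

Lemma eigenvalues_finite f :
  exists s : seq F, forall a v, v != 0 -> f v = a *: v -> a \in s.
Proof.
pose A := lin1_mx (v2r \o f \o r2v).
have [s sE] := closed_field_poly_normal (char_poly A); exists s => a v v0 fv.
have : root (char_poly A) a.
  rewrite -eigenvalue_root_char; apply/eigenvalueP; exists (v2r v).
    by rewrite mul_rV_lin1 /= v2rK fv linearZ.
  by rewrite (can2_eq v2rK r2vK) linear0.
rewrite sE (monicP (char_poly_monic A)) scale1r.
by rewrite root_prod_XsubC.
Qed.

End Eigenvectors.

(** Climb from [a] to some [a + p.+1%:R] satisfying [P] as long as one exists. In characteristic 0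
    the value [a] never returns, so it can be deleted from [s], and the climb stops. *)
Lemma maximal_shift (F : numDomainType) (P : F -> Prop) (s : seq F) (a : F) :
  (forall x, P x -> x \in s) -> P a ->
  exists2 b, P b & forall p, ~ P (b + p.+1%:R).
Proof.
have [d] := ubnP (size s); elim: d s P a => // d IHd s P a sd Ps Pa.
have [[p Pp]|nP] := pselect (exists p, P (a + p.+1%:R)); last first.
  by exists a => // p Pp; apply: nP; exists p.
pose Q x := P x /\ exists p, x = a + p.+1%:R.
have [|x [Px [q xE]]||b [Pb [q bE]] bmax] := IHd (rem a s) Q (a + p.+1%:R).
- by have sa := Ps a Pa; rewrite size_rem //; case: (s) sd sa.
- apply: rem_mem; last exact: Ps.
  by rewrite xE -subr_eq0 addrC addKr pnatr_eq0.
- by split=> //; exists p.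
exists b => // r Pr; apply: (bmax r); split=> //; exists (q + r.+1)%N.
by rewrite bE -addrA -natrD addSn.
Qed.

(** A subspace inside [P] is enlarged by one vector at a time, by induction on its codimension. This
    turns the orbit of a vector into a [{vspace V}] to which irreducibility applies. *)
Lemma vspace_of_pred (F : fieldType) (V : vectType F) (P : V -> Prop) :
  P 0 -> (forall a u v, P u -> P v -> P (a *: u + v)) ->
  exists U : {vspace V}, forall v, v \in U <-> P v.
Proof.
move=> P0 PD.
suff: forall d (U : {vspace V}), (\dim {:V} - \dim U <= d)%N ->
    (forall v, v \in U -> P v) -> exists U : {vspace V}, forall v, v \in U <-> P v.
  move=> /(_ _ 0%VS (leqnn _)); apply=> v; rewrite memv0 => /eqP->; exact: P0.
elim=> [|d IHd] U dU UP.
  exists U => v; split=> [|_]; first exact: UP.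
  have /eqP -> : U == fullv by rewrite eqEdim subvf -subn_eq0 -leqn0.
  exact: memvf.
have [PU|/existsNP[v /not_implyP[Pv vU]]] := pselect (forall v, P v -> v \in U).
  by exists U => v; split; [exact: UP | exact: PU].
apply: (IHd (U + <[v]>)%VS); last first.
  move=> w /memv_addP[u uU [x /vlineP[a ->] ->]].
  by rewrite addrC; apply: PD => //; exact: UP.
rewrite -ltnS; apply: leq_trans dU; apply: ltn_sub2l.
  rewrite ltnNge; apply/negP => dU; case: vU.
  have /eqP -> : U == fullv by rewrite eqEdim subvf.
  exact: memvf.
rewrite ltnNge; apply/negP => dU; case: vU.
have /eqP -> : U == (U + <[v]>)%VS by rewrite eqEdim addvSl.
by apply: subvP (addvSr _ _) _ _; exact: memv_line.
Qed.

(** * Weights and straightening *)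

Section HighestWeight.
Context (R : realType) (n l : nat) (V : vectType R[i]) (rho : representation n l V).
Local Notation C := R[i].
Local Notation op := (op rho).
Local Notation op_sq := (op_sq rho).
Local Notation singular := (singular rho).
Local Notation eps := (eps C l).

Lemma eps_sq (i : 'I_n) : eps i * eps i = 1.
Proof. by rewrite /Defs.eps; case: ifP; rewrite ?mulrNN mulr1. Qed.

(** The operator H of the introduction. The factor eps_i / 2 cancels the 2 eps_i in [op_weight], and
    the weight - i yields the shift k - j for b_jk. *)
Definition height : 'End(V) :=
  \sum_(i < n) (- (i%:R * eps i / 2%:R)) *: op 3 i i.

(** The case r = 1 of [reflection_op]: as [op 1] is zero and [op 2] is scalar, each surviving
    quadratic term collapses to a multiple of one generator. *)
Lemma op_weight (i j k : 'I_n) s v :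
  op 3 i i (op s j k v) = op s j k (op 3 i i v)
    + (2%:R * eps i * ((i == j)%:R - (i == k)%:R)) *: op s j k v.
Proof.
have := reflection_op rho 1 s i i j k v.
have sql w : op_sq 2 s i k w = eps i *: op s i k w.
  rewrite /op_sq (bigD1 i) //= big1 => [|a ai].
    by rewrite addr0 op_eps eqxx mulr1n.
  by rewrite op_eps eq_sym (negPf ai) mulr0n scale0r.
have sqr w : op_sq s 2 j i w = eps i *: op s j i w.
  rewrite /op_sq (bigD1 i) //= big1 => [|a ai].
    by rewrite addr0 op_eps eqxx mulr1n linearZ.
  by rewrite op_eps (negPf ai) mulr0n scale0r linear0.
have z1 p i1 i2 : op_sq 1 p i1 i2 v = 0.
  by rewrite /op_sq big1 // => a _; rewrite op1 zero_lfunE.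
have z2 p i1 i2 : op_sq p 1 i1 i2 v = 0.
  by rewrite /op_sq big1 // => a _; rewrite op1 zero_lfunE linear0.
rewrite sql sqr !z1 !z2 !op1 !op_eps !zero_lfunE !(linear0, subr0, addr0) /=.
move=> /(canRL (subrK _)) ->; rewrite addrC linearZ /= mul0rn subr0; congr (_ + _).
rewrite (eq_sym j i).
case: (eqVneq i j) => [<-|ij]; case: (eqVneq i k) => [<-|ik];
  rewrite ?mulr1n ?mulr0n ?scale0r ?subr0 ?subrr ?mulr0 ?scale0r ?addr0 //.
- by rewrite add0r subrr.
- by rewrite mulr1 mulr_natl mulr2n scalerDl.
- by rewrite !sub0r mulrN1 mulr_natl mulr2n opprD scalerDl !scaleNr.
Qed.

Lemma height_op s (j k : 'I_n) v :
  height (op s j k v) = op s j k (height v) + (k%:R - j%:R) *: op s j k v.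
Proof.
rewrite /height !sum_lfunE linear_sum.
under eq_bigr do rewrite scale_lfunE op_weight scalerDr scalerA.
under [X in X + _]eq_bigr do rewrite scale_lfunE linearZ /=.
rewrite big_split /=; congr (_ + _); rewrite -scaler_suml; congr (_ *: _).
have two : 2%:R != 0 :> C by rewrite pnatr_eq0.
have E (i : 'I_n) : - (i%:R * eps i / 2%:R) *
    (2%:R * eps i * ((i == j)%:R - (i == k)%:R)) =
    i%:R * (i == k)%:R - i%:R * (i == j)%:R :> C.
  transitivity (i%:R * ((i == k)%:R - (i == j)%:R) * (eps i * eps i) : C).
    by field.
  by rewrite eps_sq mulr1 mulrBr.
rewrite (eq_bigr _ (fun i _ => E i)) sumrB.
have D (x : 'I_n) : \sum_(i < n) i%:R * (i == x)%:R = x%:R :> C.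
  by rewrite (bigD1 x) //= eqxx mulr1 big1 ?addr0 // => i /negPf->; rewrite mulr0.
by rewrite !D.
Qed.

Lemma height_eigen_op s (j k : 'I_n) v a : height v = a *: v ->
  height (op s j k v) = (a + (k%:R - j%:R)) *: op s j k v.
Proof. by move=> hv; rewrite height_op hv linearZ -scalerDl. Qed.

Lemma exists_top_eigenspace : fullv != 0%VS :> {vspace V} ->
  exists2 a, lker (height - a *: \1%VF) != 0%VS &
    forall p v, height v = (a + p.+1%:R) *: v -> v = 0.
Proof.
move=> V0; have [s hs] := eigenvalues_finite height.
have [a [v [_ v0 hv]]] :=
  @invariant_eigenvector _ _ height _ V0 (fun v _ => memvf _).
pose P x := exists2 v, v != 0 & height v = x *: v.
have [|a' [u u0 hu] amax] := @maximal_shift _ P s a _ (ex_intro2 _ _ v v0 hv).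
  by move=> x [w w0 hw]; exact: hs hw.
exists a'.
  apply/eqP => /vspaceP/(_ u).
  rewrite memv_ker add_lfunE opp_lfunE scale_lfunE id_lfunE hu subrr eqxx.
  by rewrite memv0 (negPf u0).
move=> p w hw; apply/eqP/negPn/negP => w0; apply: (amax p).
by exists w.
Qed.

Lemma exists_weight_vector : fullv != 0%VS :> {vspace V} ->
  exists v, [/\ v != 0, singular v & forall r i, exists a, op r i i v = a *: v].
Proof.
move=> /exists_top_eigenspace[a W0 top].
set W := lker _ in W0.
have WP v : v \in W -> height v = a *: v.
  by rewrite memv_ker add_lfunE opp_lfunE scale_lfunE id_lfunE subr_eq0 => /eqP.
have Wsing v : v \in W -> singular v.
  (* b_ij raises the eigenvalue by j - i > 0, beyond the top one. *)
  move=> /WP hv r i j ij; apply: (top (j - i).-1).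
  by rewrite (height_eigen_op _ _ _ hv) prednK ?subn_gt0 // natrB // ltnW.
have [| |v [vW v0 vE]] := @common_eigenvector_in _ _ (nat * 'I_n)%type
    (fun ri => op ri.1 ri.2 ri.2) W W0.
- move=> ri v /WP hv; rewrite memv_ker add_lfunE opp_lfunE scale_lfunE id_lfunE.
  by rewrite (height_eigen_op _ _ _ hv) subrr addr0 subrr.
- by move=> ri sj v /Wsing/singular_diag_comm->.
by exists v; split=> // [|r i]; [exact: Wsing | exact: (vE (r, i))].
Qed.

Lemma irreducible_cyclic v : irreducible rho -> v != 0 ->
  forall u, exists x, rho x v = u.
Proof.
move=> [_ irr] v0.
have [||U UP] := @vspace_of_pred _ _ (fun u => exists x, rho x v = u).
- by exists 0; rewrite linear0 zero_lfunE.
- move=> a _ _ [x <-] [y <-]; exists (a *: x + y).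
  by rewrite linearP add_lfunE scale_lfunE.
have vU : v \in U by apply/UP; exists 1; rewrite rep_act1 id_lfunE.
have [x|U0|Ufull] := irr U; last by move=> u; apply/UP; rewrite Ufull memvf.
  apply/subvP => _ /memv_imgP[u /UP[y <-] ->]; apply/UP; exists (x * y).
  exact: rep_act_mul.
by move: vU v0; rewrite U0 memv0 => ->.
Qed.

Definition letter : Type := nat * 'I_n * 'I_n.

Definition word_act (w : seq letter) (v : V) : V :=
  foldr (fun x u => op x.1.1 x.1.2 x.2 u) v w.

(** Counts padded superscripts. Since the scalars [op 2] are letters too, every term of the
    reflection equation is a word of two letters. *)
Definition word_weight (w : seq letter) : nat := sumn [seq x.1.1 | x <- w].

Lemma word_act_cat w1 w2 v : word_act (w1 ++ w2) v = word_act w1 (word_act w2 v).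
Proof. exact: foldr_cat. Qed.

Lemma word_act0 w : word_act w 0 = 0.
Proof. by elim: w => //= x w ->; rewrite linear0. Qed.

Lemma word_actB w u v : word_act w (u - v) = word_act w u - word_act w v.
Proof. by elim: w => //= x w ->; rewrite linearB. Qed.

Section Straightening.
Variables (Q : V -> Prop) (Q0 : Q 0) (QB : forall u v, Q u -> Q v -> Q (u - v)).

Let QN u : Q u -> Q (- u). Proof. by rewrite -sub0r; exact: QB. Qed.
Let QD u v : Q u -> Q v -> Q (u + v).
Proof. by move=> Qu /QN; rewrite -{2}[v]opprK; exact: QB. Qed.

(** [reflection_op] expresses the commutator in degrees (r + 2, s) by the one in (r, s + 2) and by
    products of total degree at most r + s + 1. The induction goes by steps of two, hence the paired
    claim for r and r + 1, and starts from [op 0] = [op 1] = 0. *)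
Lemma commutator_lower N v :
  (forall r s i j k m, (r + s < N)%N -> Q (op r i j (op s k m v))) ->
  forall r s i j k m, (r + s <= N)%N ->
    Q (op r i j (op s k m v) - op s k m (op r i j v)).
Proof.
move=> Qop2.
have Qsq r s i j : (r + s < N)%N -> Q (op_sq r s i j v).
  by move=> rs; apply: big_ind => // a _; exact: Qop2.
suff IH r : (forall s i j k m, (r + s <= N)%N ->
      Q (op r i j (op s k m v) - op s k m (op r i j v))) /\
    (forall s i j k m, (r.+1 + s <= N)%N ->
      Q (op r.+1 i j (op s k m v) - op s k m (op r.+1 i j v))).
  by move=> r; have [] := IH r.
elim: r => [|r [IH0 IH1]].
  by split=> s i j k m _; rewrite ?op0 ?op1 !zero_lfunE linear0 subr0.
split=> // s i j k m rs.
have rs1 : (r.+1 + s < N)%N by [].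
have rs2 : (r + s.+1 < N)%N by rewrite addnS.
have rs3 : (r + s < N)%N by apply: leq_trans rs1.
have sr1 : (s + r.+1 < N)%N by rewrite addnC.
have sr2 : (s.+1 + r < N)%N by rewrite addnC.
have sr3 : (s + r < N)%N by rewrite addnC.
rewrite [X in Q X](canRL (subrK _) (reflection_op rho r s i j k m v)).
have QMn (b : bool) u : Q u -> Q (u *+ b) by case: b.
apply: QD; last by apply: IH0; rewrite addnS addnS.
apply: QB; last by apply: QMn; apply: QB; exact: Qsq.
apply: QB; last by apply: QMn; apply: QB; exact: Qsq.
apply: QD; last by apply: QMn; apply: QB; exact: Qsq.
by apply: QB; [apply: QB; [apply: QD |] |]; exact: Qop2.
Qed.

End Straightening.

(* Commutators of generators lower the total index, so a raising generator can be
   moved to the right of any word, where it annihilates v. *)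
Lemma straightening (Q : V -> Prop) (v : V) :
  Q 0 -> (forall u w, Q u -> Q w -> Q (u - w)) -> singular v ->
  (forall w : seq letter, all (fun x : letter => (x.2 <= x.1.2)%N) w ->
    Q (word_act w v)) ->
  forall w, Q (word_act w v).
Proof.
move=> Q0 QB vsing Qlow w.
have [N] := ubnP (word_weight w); elim: N w => // N IHN w wN.
have [/Qlow//|] := boolP (all (fun x : letter => (x.2 <= x.1.2)%N) w).
rewrite -has_predC => /hasP[x xw].
case/splitPr: w / xw wN => w1 w2 wN; rewrite /= -ltnNge => xup.
(* Inner induction on the number of letters to the right of the raising letter [x]: [Qswap] moves
   [x] past [y] at equal weight, and [Qcomm] reduces the commutator to words of smaller weight. *)
elim: w2 w1 wN => [|y w2 IHw] w1 wN.
  by rewrite word_act_cat /= vsing // word_act0.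
pose u := word_act w2 v.
have Qswap : Q (word_act w1 (op y.1.1 y.1.2 y.2 (op x.1.1 x.1.2 x.2 u))).
  have := IHw (rcons w1 y); rewrite cat_rcons word_act_cat; apply.
  move: wN; rewrite /word_weight !map_cat !sumn_cat /=; lia.
have Qcomm : Q (word_act w1 (op x.1.1 x.1.2 x.2 (op y.1.1 y.1.2 y.2 u)
                  - op y.1.1 y.1.2 y.2 (op x.1.1 x.1.2 x.2 u))).
  pose Q' z := Q (word_act w1 z).
  apply: (@commutator_lower Q' _ _ (x.1.1 + y.1.1)%N) => //.
  - by rewrite /Q' word_act0.
  - by move=> z z' Qz Qz'; rewrite /Q' word_actB; exact: QB.
  move=> r s i j k m rs.
  have := IHN (w1 ++ (r, i, j) :: (s, k, m) :: w2); rewrite word_act_cat; apply.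
  move: wN rs; rewrite /word_weight !map_cat !sumn_cat /=; lia.
rewrite word_act_cat /= -/u -[word_act w1 _](subrK
  (word_act w1 (op y.1.1 y.1.2 y.2 (op x.1.1 x.1.2 x.2 u)))) -word_actB.
by rewrite -[X in _ + X]opprK; apply: (QB) => //; rewrite -sub0r; exact: QB.
Qed.

End HighestWeight.

(** * Uniqueness of the highest vector *)

Section Uniqueness.
Context (R : realType) (n l : nat) (V : vectType R[i]) (rho : representation n l V).
Local Notation C := R[i].
Local Notation op := (op rho).
Local Notation singular := (singular rho).
Local Notation height := (height rho).
Local Notation word_act := (word_act rho).

(** A free generator with index r stands for b_ij^(r+1), and the padding adds 2; hence [.+3]. *)
Lemma rep_act_monomial (m : seq (nat * 'I_n * 'I_n)) v :
  rho (quot_proj (reflection_relation l) << FMonom m >>) v =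
  word_act [seq (x.1.1.+3, x.1.2, x.2) | x <- m] v.
Proof.
elim: m => [|x m IHm] /=.
  have -> : << FMonom [::] >> = 1 :> free_refl R n by rewrite -fmoneE.
  by rewrite rmorph1 rep_act1 id_lfunE.
have -> : << FMonom (x :: m) >> = free_gen R x.1.1 x.1.2 x.2 * << FMonom m >>.
  case: x => [[r i] j]; rewrite /free_gen /free_alg_gen.
  rewrite malgM_def fgmulUU mulr1; congr << _ >>.
  by rewrite fmuE -[mmul _ _]/(fmmul _ _) fmmulE.
rewrite rmorphM rep_act_mul IHm; congr (rho _ _).
by rewrite /op mxE mxE.
Qed.

Lemma rep_act_words (Q : V -> Prop) v :
  Q 0 -> (forall a u w, Q u -> Q w -> Q (a *: u + w)) ->
  (forall w, Q (word_act w v)) -> forall x, Q (rho x v).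
Proof.
move=> Q0 QD Qw x; have [y <-] := quot_proj_surj x.
rewrite [y]monalgE linear_sum linear_sum sum_lfunE.
apply: big_ind => // [u w Qu Qw'|k _]; first by rewrite -[u]scale1r; exact: QD.
have -> : << y@_k *g k >> = y@_k *: << k >> :> free_refl R n.
  apply/malgP=> k'; rewrite mcoeffZ !mcoeffU mulrnAr mulr1 //.
rewrite !linearZ scale_lfunE -[_ *: _]addr0; apply: QD => //.
by rewrite -[k]fmK rep_act_monomial.
Qed.

(** The product of the factors H - (a - p), 1 <= p <= N, applied to [v]: it kills the eigenspaces of
    H for a - 1, ..., a - N and replaces an explicit eigenspace decomposition of V. *)
Fixpoint lower_kill (a : C) N v :=
  if N is N'.+1 then
    let u := lower_kill a N' v in height u - (a - N'.+1%:R) *: u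
  else v.

Lemma lower_kill_linear a N c u w :
  lower_kill a N (c *: u + w) = c *: lower_kill a N u + lower_kill a N w.
Proof.
elim: N => //= N ->; rewrite linearP [X in _ - X]scalerDr opprD addrACA.
by rewrite scalerBr !scalerA [c * _]mulrC.
Qed.

Lemma lower_kill_eigen a b N u : height u = b *: u ->
  lower_kill a N u = (\prod_(p < N) (b - (a - p.+1%:R))) *: u.
Proof.
move=> hu; elim: N => /= [|N ->]; first by rewrite big_ord0 scale1r.
rewrite linearZ /= hu !scalerA -scalerBl big_ord_recr /= mulrBr.
by rewrite [_ * (a - _)]mulrC.
Qed.

Lemma lower_word_act (w : seq (letter n)) a v :
  height v = a *: v -> (forall r i, exists b, op r i i v = b *: v) ->
  all (fun x : letter n => (x.2 <= x.1.2)%N) w ->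
  (exists c, word_act w v = c *: v) \/
  (exists p, height (word_act w v) = (a - p.+1%:R) *: word_act w v).
Proof.
move=> hv dv; elim: w => [|[[r i] j] w IHw] /=.
  by left; exists 1; rewrite scale1r.
case/andP=> ji /IHw; rewrite leq_eqVlt in ji; case/orP: ji => [/eqP/val_inj->|ji].
  case=> [[c ->]|[p hp]].
    by left; have [b vb] := dv r i; exists (c * b); rewrite linearZ /= vb scalerA.
  by right; exists p; rewrite (height_eigen_op _ _ _ hp) subrr addr0.
have E p : a - p%:R + (j%:R - i%:R) = a - (p + (i - j).-1).+1%:R :> C.
  rewrite -addnS prednK ?subn_gt0 // natrD natrB ?(ltnW ji) //; ring.
case=> [[c ->]|[p hp]]; right.
  exists (i - j).-1; rewrite linearZ /= linearZ /= (height_eigen_op _ _ _ hv).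
  by have := E 0%N; rewrite subr0 add0n => ->; rewrite !scalerA mulrC.
by exists (p.+1 + (i - j).-1)%N; rewrite (height_eigen_op _ _ _ hp) E.
Qed.

(** By straightening, every vector is sent to the line of [v] by some [lower_kill a N]. On the
    eigenvector [u] this is multiplication by [d], a product of factors b - (a - p): either one
    factor vanishes, or [d] can be inverted. *)
Lemma cyclic_eigenvector a b v u :
  (forall u, exists x, rho x v = u) -> singular v ->
  height v = a *: v -> (forall r i, exists c, op r i i v = c *: v) ->
  height u = b *: u ->
  (exists c, u = c *: v) \/ exists p, b = a - p.+1%:R.
Proof.
move=> cyc vsing hv dv hu.
pose Q u := exists N c, lower_kill a N u = c *: v.
(* Further factors preserve the line of the H-eigenvector [v], so two vectors can be given a common
   [N]. *)
have QS N k w : (exists c, lower_kill a N w = c *: v) ->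
    exists c, lower_kill a (k + N) w = c *: v.
  move=> Nw; elim: k => //= k [c ->].
  exists (c * a - (a - (k + N).+1%:R) * c).
  by rewrite linearZ /= hv !scalerA scalerBl.
have Q0 : Q 0 by exists 0%N, 0; rewrite scale0r.
have QD x w w' : Q w -> Q w' -> Q (x *: w + w').
  move=> [N Nw] [N' N'w]; exists (N' + N)%N.
  have [c wc] := QS _ N' _ Nw; have := QS _ N _ N'w; rewrite addnC => -[c' wc'].
  by exists (x * c + c'); rewrite lower_kill_linear wc wc' scalerA scalerDl.
have Qu : Q u.
  have [x <-] := cyc u; apply: rep_act_words => //.
  apply: straightening => // [w w' Qw Qw'|w].
    by rewrite addrC -scaleN1r; exact: QD.
  case/(lower_word_act hv dv) => [[c wc]|[p hp]]; first by exists 0%N, c.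
  exists p.+1, 0; rewrite (lower_kill_eigen _ _ hp) big_ord_recr /= subrr mulr0.
  by rewrite !scale0r.
have [N [c]] := Qu; rewrite (lower_kill_eigen _ _ hu).
set d := \prod_(p < N) _; have [/eqP|d0] := eqVneq d 0.
  rewrite prodf_seq_eq0 => /hasP[p _ /=]; rewrite subr_eq0 => /eqP ->.
  by move=> _; right; exists p.
move=> /(congr1 ( *:%R d^-1)); rewrite !scalerA mulVf // scale1r => ->.
by left; exists (d^-1 * c).
Qed.

Lemma highest_vector_eigen v : highest_vector rho v ->
  [/\ singular v, exists a, height v = a *: v &
      forall r i, exists a, op r i i v = a *: v].
Proof.
move=> [_ _ up [mu muE]].
have dv r i : exists a, op r i i v = a *: v.
  case: r => [|[|r]]; first by exists 0; rewrite op0 zero_lfunE scale0r.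
    by exists 0; rewrite op1 zero_lfunE scale0r.
  by exists (mu i r); have [_ ->] := muE i.
split=> //.
  move=> [|[|r]] i j ij; first by rewrite op0 zero_lfunE.
    by rewrite op1 zero_lfunE.
  exact: up.
exists (\sum_(i < n) - (i%:R * eps C l i / 2%:R) * mu i 1%N).
rewrite /height sum_lfunE scaler_suml; apply: eq_bigr => i _.
by rewrite scale_lfunE -scalerA; have [_ <-] := muE i.
Qed.

End Uniqueness.

Theorem theorem4p1 (R : realType) (n k l : nat) (n_eq : n = (k + l)%N)
    (l_le : (2 * l <= n)%N) (V : vectType R[i])
    (rho : representation n l V) :
  irreducible rho ->
  highest_weight rho /\
  (forall xi xi' : V, highest_vector rho xi -> highest_vector rho xi' ->
     exists2 c : R[i], c != 0 & xi' = c *: xi).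
Proof.
move=> irr; split.
  have [v [v0 vsing vdiag]] := exists_weight_vector rho (proj1 irr).
  exists v; split=> //.
  - exact: irreducible_cyclic.
  - by move=> i j ij r; exact: (vsing r.+2).
  - have [mu muE] := choice (fun ri : nat * 'I_n => vdiag ri.1.+2 ri.2).
    (* [choice] returns unspecified eigenvalues, so the constant term is set to eps_i explicitly;
       [op_eps] justifies it. *)
    exists (fun i r => if r is 0%N then eps R[i] l i else mu (r, i)) => i.
    split=> // -[|r]; last exact: (muE (r.+1, i)).
    by rewrite -[LHS]/(op rho 2 i i v) op_eps eqxx mulr1n.
move=> xi xi' hx hx'.
have [s [a ha] d] := highest_vector_eigen hx.
have [s' [a' ha'] d'] := highest_vector_eigen hx'.
have [x0 cyc _ _] := hx; have [x0' cyc' _ _] := hx'.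
have [[c xE]|[p aE]] := cyclic_eigenvector cyc s ha d ha'.
  by exists c => //; apply: contraNneq x0' => c0; rewrite xE c0 scale0r.
have [[c xE]|[q aE']] := cyclic_eigenvector cyc' s' ha' d' ha.
  have c0 : c != 0 by apply: contraNneq x0 => c0; rewrite xE c0 scale0r.
  by exists c^-1; rewrite ?invr_eq0 // xE scalerA mulVf // scale1r.
(* Each eigenvalue would lie strictly below the other, which characteristic 0 excludes. *)
have E : a' = a' - q.+1%:R - p.+1%:R by rewrite -aE' -aE.
have /eqP : (p.+1 + q.+1)%:R = 0 :> R[i].
  rewrite natrD; transitivity (a' - (a' - q.+1%:R - p.+1%:R)); first by ring.
  by rewrite -E subrr.
by rewrite pnatr_eq0.
Qed.
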